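(* For the DRB game in a $k$-dimensional grid, for all sufficiently large $n$, the random small-world network $\mathbf r\equiv 0$ is not a $2$-strong Nash equilibrium.
   Context: DRB (Distance-Reciprocity Balanced) game. Fix an integer $k\ge 1$ and $\gamma=1/g$ with $g\ge 2$ an integer. For an integer $n\ge 2$ let $V=\{1,\dots,n\}^k$, viewed as a torus grid with distance $d_M(u,v)=\sum_{i=1}^k\min\{|u_i-v_i|,\,n-|u_i-v_i|\}$. Each node $u\in V$ is a player with strategy $r_u\in\Sigma=\{0,\gamma,2\gamma,3\gamma,\dots\}$ and a constant exponent $\alpha_u>0$. For $r\ge 0$ let $c(r)=\sum_{v\ne u}d_M(u,v)^{-r}$ (independent of $u$) and $p_u(v,r)=d_M(u,v)^{-r}/c(r)$ for $v\neq u$. The payoff of $u$ under the strategy profile $\mathbf r=(r_v)_{v\in V}$ is $$\pi_u(\mathbf r)=\pi_u(r_u,\mathbf r_{-u})=\Big(\sum_{v\ne u}p_u(v,r_u)\,d_M(u,v)\Big)^{\alpha_u}\Big(\sum_{v\ne u}p_u(v,r_u)\,p_v(u,r_v)\Big).$$ $\mathbf r\equiv s$ means $r_u=s$ for all $u\in V$. For $t\in\{1,\dots,|V|\}$, a profile $\mathbf r^*$ is a $t$-strong Nash equilibrium if for every nonempty $C\subseteq V$ with $|C|\le t$ there is no $\mathbf r_C\in\Sigma^C$ such that $\pi_u(\mathbf r_C,\mathbf r^*_{-C})\ge\pi_u(\mathbf r^* )$ for all $u\in C$ and $\pi_u(\mathbf r_C,\mathbf r^*_{-C})>\pi_u(\mathbf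 r^* )$ for some $u\in C$ (here $(\mathbf r_C,\mathbf r^*_{-C})$ is the profile where players in $C$ use $\mathbf r_C$ and the others use $\mathbf r^*$). ''For sufficiently large $n$'' means: there is $n_0$ depending only on the model constants such that the statement holds for all $n\ge n_0$. The model constants are $k,\gamma$ and the exponents; precisely, given constants $0<\alpha_{\min}\le\alpha_{\max}$, $n_0$ depends only on $k,\gamma,\alpha_{\min},\alpha_{\max}$, and the exponents are arbitrary with $\alpha_u\in[\alpha_{\min},\alpha_{\max}]$ for all $u$. *)

(* Defs.v *)
From HB Require Import structures.
From mathcomp Require Import all_boot all_order all_algebra.
From mathcomp Require Import all_classical all_reals all_analysis.

Set Implicit Arguments.
Unset Strict Implicit.
Unset Printing Implicit Defensive.

Import Order.TTheory GRing.Theory Num.Theory.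

Local Open Scope classical_set_scope.
Local Open Scope ring_scope.

(* Coordinates run over {0, ..., n-1} instead of {1, ..., n}; the torus
   distance depends only on coordinate differences. *)
Notation node n k := {ffun 'I_k -> 'I_n}.

Definition dist (n k : nat) (u v : node n k) : nat :=
  (\sum_(i < k) minn `|u i - v i| (n - `|u i - v i|))%N.

Section DRB.
Variables (R : realType) (g n k : nat).
Local Notation V := (node n k).

(* The strategy space {0, gamma, 2 gamma, ...} with gamma = 1 / g. *)
Definition Sigma : set R := [set m%:R * (1 / g%:R) | m in [set: nat]].

Definition strategy : Type := {x : R | Sigma x}.

Lemma Sigma0 : Sigma 0.
Proof. by exists 0%N => //; rewrite mul0r. Qed.

Definition strategy0 : strategy := exist _ 0 Sigma0.

Definition profile : Type := V -> strategy.

(* By translation invariance of the torus this does not depend on u. *)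
Definition norm_const (u : V) (r : R) : R :=
  \sum_(v | v != u) (dist u v)%:R `^ (- r).

Definition link_prob (u v : V) (r : R) : R :=
  (dist u v)%:R `^ (- r) / norm_const u r.

Definition payoff (alpha : V -> R) (r : profile) (u : V) : R :=
  (\sum_(v | v != u) link_prob u v (sval (r u)) * (dist u v)%:R) `^ alpha u *
  (\sum_(v | v != u)
     link_prob u v (sval (r u)) * link_prob v u (sval (r v))).

(* The profile (rC, r_{-C}); the values of rC outside C are ignored, so total
   profiles rC stand for elements of Sigma^C. *)
Definition deviate (C : {set V}) (rC r : profile) : profile :=
  fun u => if u \in C then rC u else r u.

Definition strong_nash (alpha : V -> R) (t : nat) (r : profile) : Prop :=
  forall C : {set V}, C != finset.set0 -> (#|C| <= t)%N ->
  ~ exists rC : profile,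
      (forall u, u \in C ->
         payoff alpha (deviate C rC r) u >= payoff alpha r u) /\
      (exists2 u, u \in C &
         payoff alpha (deviate C rC r) u > payoff alpha r u).

End DRB.

(* Main.v *)
Require Import Defs.
From HB Require Import structures.
From mathcomp Require Import all_boot all_order all_algebra.
From mathcomp Require Import all_classical all_reals all_analysis.
From mathcomp Require Import zify ring lra.

Set Implicit Arguments.
Unset Strict Implicit.
Unset Printing Implicit Defensive.

Import Order.TTheory GRing.Theory Num.Theory.

Local Open Scope ring_scope.

(* Two adjacent nodes deviate together to the exponent k. The normalizing
   constant c(k) is only polylogarithmic in n: since d >= 1, the product of the
   d_i + 1 over the coordinates is at most (2 d)^k, so the sum of d^(-k) is at
   most 2^k times a product of k one-dimensional sums of 1 / (d_i + 1), each of
   them at most twice a harmonic number. Bounding d^(1-k) below by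
   (k n)^(1-k) shows that the mean distance loses only a factor O(c(k)), hence
   the first factor of the payoff loses only a polylogarithmic factor, because
   the exponents are bounded. The second factor grows from 1 / (n^k - 1) to at
   least 1 / c(k)^2, contributed by the deviating partner alone. *)

(** * Coordinatewise distance on the torus *)

Definition cdist (n : nat) (a b : 'I_n) : nat :=
  (minn `|a - b| (n - `|a - b|))%N.

Lemma distE n k (u v : node n k) :
  dist u v = (\sum_(i < k) cdist (u i) (v i))%N.
Proof. by []. Qed.

Lemma cdist_eq0 n (a b : 'I_n) : cdist a b = 0%N -> a = b.
Proof.
rewrite /cdist => ab; apply: ord_inj.
by move: ab (ltn_ord a) (ltn_ord b); lia.
Qed.

Lemma cdistC n (a b : 'I_n) : cdist a b = cdist b a.
Proof. by rewrite /cdist; lia. Qed.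

Lemma distC n k (u v : node n k) : dist u v = dist v u.
Proof. by rewrite !distE; apply: eq_bigr => i _; rewrite cdistC. Qed.

Lemma dist_gt0 n k (u v : node n k) : v != u -> (0 < dist u v)%N.
Proof.
rewrite lt0n; apply: contraNneq => uv0; apply/eqP/ffunP => i.
apply/esym/cdist_eq0/eqP; rewrite -leqn0 -uv0 distE.
by rewrite (bigD1 i) //= leq_addr.
Qed.

Lemma dist_le n k (u v : node n k) : (dist u v <= k * n)%N.
Proof.
rewrite distE -[k in (k * _)%N]card_ord -sum_nat_const leq_sum// => i _.
by rewrite /cdist; have := ltn_ord (u i); have := ltn_ord (v i); lia.
Qed.

Lemma prod_cdist_le n k (u v : node n k) : v != u ->
  (\prod_(i < k) (cdist (u i) (v i)).+1 <= (2 * dist u v) ^ k)%N.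
Proof.
move=> vu; rewrite -[k in (_ ^ k)%N]card_ord -prod_nat_const leq_prod// => i _.
have d0 := dist_gt0 vu.
suff : (cdist (u i) (v i) <= dist u v)%N by lia.
by rewrite distE (bigD1 i) //= leq_addr.
Qed.

Lemma card_others n k (u : node n k) : #|[pred v | v != u]| = (n ^ k).-1.
Proof. by rewrite cardC1 card_ffun !card_ord. Qed.

Section Real.
Variable R : realType.

(** * Harmonic sums and one-dimensional distance sums *)

Definition harmonic_sum (n : nat) : R := \sum_(j < n) j.+1%:R^-1.

Lemma harmonic_sum_ge1 n : 1 <= harmonic_sum n.+1.
Proof.
rewrite /harmonic_sum big_ord_recl/= invr1 lerDl.
by apply: sumr_ge0 => j _; rewrite invr_ge0.
Qed.

Lemma harmonic_sum_le n : harmonic_sum n.+1 <= 1 + ln n.+1%:R.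
Proof.
rewrite /harmonic_sum; elim: n => [|n IH].
  by rewrite big_ord_recr big_ord0/= ln1 invr1; lra.
rewrite big_ord_recr/= (le_trans (lerD IH (lexx _)))// -addrA lerD2l.
have n0 : 0 < n.+1%:R :> R by rewrite ltr0n.
have m0 : 0 < n.+2%:R :> R by rewrite ltr0n.
(* The bound ln (1 - x) <= -x at x = 1 / (n + 2) yields 1 / (n + 2) <= ln (n + 2) - ln (n + 1), the
   increment needed. *)
have : ln (1 + - n.+2%:R^-1) <= - n.+2%:R^-1 :> R.
  by rewrite le_ln1Dx// ltrN2 invf_lt1 ?ltr1n.
have -> : 1 + - n.+2%:R^-1 = n.+1%:R / n.+2%:R :> R.
  by rewrite -[n.+2%:R]natr1 in m0 *; field; rewrite gt_eqF.
by rewrite ln_div ?posrE// lerBlDl => h; rewrite -lerBrDr.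
Qed.

(** An injective map of a finite set into itself is a permutation, so the terms are only
    reordered. *)
Lemma sum_reindex_ord n (f : 'I_n -> nat) :
  injective f -> (forall j, (f j < n)%N) ->
  \sum_(j < n) (f j).+1%:R^-1 = harmonic_sum n.
Proof.
move=> finj flt; rewrite /harmonic_sum.
rewrite [RHS](reindex_inj (h := fun j => Ordinal (flt j)))//.
by move=> i j /(congr1 val)/finj.
Qed.

Lemma sum_cdist_le n (a : 'I_n) :
  \sum_(j < n) (cdist a j).+1%:R^-1 <= 2 * harmonic_sum n.
Proof.
(* The residues of j - a and a - j mod n: cdist is their minimum, and each of
   them is a permutation of 'I_n as a function of j. *)
pose f (j : 'I_n) := if (a <= j)%N then (j - a)%N else (n - (a - j))%N.
pose h (j : 'I_n) := if (j <= a)%N then (a - j)%N else (n - (j - a))%N.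
have fE : \sum_(j < n) (f j).+1%:R^-1 = harmonic_sum n.
  apply: sum_reindex_ord => [i j|j]; rewrite /f;
    last by move: (ltn_ord a) (ltn_ord j); do !case: ifP; lia.
  move=> ij; apply: ord_inj; move: ij (ltn_ord a) (ltn_ord i) (ltn_ord j).
  by do !case: ifP; lia.
have hE : \sum_(j < n) (h j).+1%:R^-1 = harmonic_sum n.
  apply: sum_reindex_ord => [i j|j]; rewrite /h;
    last by move: (ltn_ord a) (ltn_ord j); do !case: ifP; lia.
  move=> ij; apply: ord_inj; move: ij (ltn_ord a) (ltn_ord i) (ltn_ord j).
  by do !case: ifP; lia.
rewrite mulr_natl mulr2n -{1}fE -hE -big_split/= ler_sum// => j _.
have [->|->] : cdist a j = f j \/ cdist a j = h j.
- by rewrite /cdist /f /h; move: (ltn_ord a) (ltn_ord j); do !case: ifP; lia.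
- by rewrite lerDl invr_ge0.
- by rewrite lerDr invr_ge0.
Qed.

(** * Normalizing constants and mean distances *)

Lemma link_weightE n k (u v : node n k) (r : nat) :
  (dist u v)%:R `^ (- r%:R) = (dist u v)%:R ^- r :> R.
Proof. by rewrite powRN powR_mulrn. Qed.

Lemma norm_const0 n k (u : node n k) : norm_const u 0 = (n ^ k).-1%:R :> R.
Proof.
rewrite /norm_const -(card_others u) -sum1_card natr_sum.
by apply: eq_bigr => v _; rewrite oppr0 powRr0.
Qed.

Lemma norm_const_le n k (u : node n k) :
  norm_const u k%:R <= (4 * harmonic_sum n) ^+ k.
Proof.
pose F (i : 'I_k) (a : 'I_n) : R := (cdist (u i) a).+1%:R^-1.
have F0 v : 0 <= \prod_(i < k) F i (v i).
  by apply: prodr_ge0 => i _; rewrite invr_ge0.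
apply: (@le_trans _ _ (2 ^+ k * \sum_(v : node n k) \prod_(i < k) F i (v i))).
  (* Adding the nonnegative term v = u makes the sum run over all nodes, so that it factorizes over
     the coordinates below. *)
  rewrite [X in _ <= _ * X](bigID (fun v => v != u))/= mulrDr.
  rewrite -[leLHS]addr0 lerD//; last by rewrite mulr_ge0 ?exprn_ge0 ?sumr_ge0.
  rewrite mulr_sumr ler_sum// => v vu.
  have d0 : 0 < (dist u v)%:R :> R by rewrite ltr0n dist_gt0.
  rewrite link_weightE prodfV -natr_prod.
  have p0 : 0 < (\prod_(i < k) (cdist (u i) (v i)).+1)%:R :> R.
    by rewrite ltr0n prodn_gt0.
  rewrite ler_pdivlMr// ler_pdivrMl ?exprn_gt0// -exprMn.
  by rewrite mulrC -natrM -natrX ler_nat prod_cdist_le.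
rewrite -(bigA_distr_bigA F).
(* Per coordinate, one factor 2 comes from [prod_cdist_le] and the other from [sum_cdist_le]. *)
have -> : 4 * harmonic_sum n = 2 * (2 * harmonic_sum n) by ring.
rewrite exprMn ler_pM2l ?exprn_gt0// -[k in leRHS]card_ord -prodr_const.
apply: ler_prod => i _; rewrite sum_cdist_le andbT.
by apply: sumr_ge0 => j _; rewrite invr_ge0.
Qed.

Lemma norm_const_gt0 n k (u v : node n k) (r : R) :
  v != u -> 0 < norm_const u r.
Proof.
move=> vu; rewrite /norm_const (bigD1 v)//= ltr_wpDr//.
  by apply: sumr_ge0 => w _; exact: powR_ge0.
by rewrite powR_gt0// ltr0n dist_gt0.
Qed.

Lemma mean_dist0_le n k (u : node n k) :
  \sum_(v | v != u) link_prob u v 0 * (dist u v)%:R <= (k * n)%:R :> R.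
Proof.
have p0 v : 0 <= link_prob u v 0 :> R.
  by rewrite mulr_ge0 ?powR_ge0// invr_ge0 sumr_ge0// => w _; exact: powR_ge0.
apply: (@le_trans _ _ (\sum_(v | v != u) link_prob u v 0 * (k * n)%:R)).
  by apply: ler_sum => v _; rewrite ler_wpM2l// ler_nat dist_le.
rewrite -mulr_suml -mulr_suml -/(norm_const u 0).
(* The constant vanishes only on the one-node torus, where the convention that 0 has inverse 0
   settles the bound. *)
have [->|c0] := eqVneq (norm_const u 0 : R) 0.
  by rewrite invr0 mulr0 mul0r.
by rewrite mulfV// mul1r.
Qed.

(** In dimension [k.+1], each of the n^(k+1) - 1 terms d^(-k) is at least ((k+1) n)^(-k). The factor
    2 absorbs the -1 in the node count. *)
Lemma mean_dist_ge n k (u : node n k.+1) : (2 <= n)%N ->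
  n%:R / (2 * k.+1%:R ^+ k * norm_const u k.+1%:R) <=
  \sum_(v | v != u) link_prob u v k.+1%:R * (dist u v)%:R :> R.
Proof.
move=> n2; have n0 : 0 < n%:R :> R by rewrite ltr0n; lia.
have c0 : 0 <= norm_const u k.+1%:R :> R.
  by apply: sumr_ge0 => v _; exact: powR_ge0.
rewrite invfM mulrA.
under eq_bigr do rewrite /link_prob mulrAC.
rewrite -mulr_suml ler_wpM2r ?invr_ge0//.
apply: (@le_trans _ _ (\sum_(v : node n k.+1 | v != u) (k.+1 * n)%:R ^- k)).
  rewrite sumr_const card_others -[_ *+ (n ^ _).-1]mulr_natl natrM exprMn.
  have kk : k.+1%:R ^+ k != 0 :> R by rewrite expf_neq0.
  have nk : 0 < n%:R ^+ k :> R by rewrite exprn_gt0.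
  rewrite ler_pdivrMr ?mulr_gt0 ?exprn_gt0//.
  have -> : (n ^ k.+1).-1%:R / (k.+1%:R ^+ k * n%:R ^+ k) * (2 * k.+1%:R ^+ k) =
    (2 * (n ^ k.+1).-1)%:R / n%:R ^+ k :> R.
    by rewrite natrM; field; rewrite gt_eqF.
  rewrite ler_pdivlMr// -exprS -natrX ler_nat.
  have : (2 <= n ^ k.+1)%N.
    by rewrite (leq_trans n2)// -{1}[n]expn1 leq_pexp2l; lia.
  by lia.
apply: ler_sum => v vu; rewrite link_weightE.
have d0 : 0 < (dist u v)%:R :> R by rewrite ltr0n dist_gt0.
rewrite exprS invfM mulrAC mulVf ?gt_eqF// mul1r lef_pV2 ?posrE ?exprn_gt0//.
- by rewrite lerXn2r ?nnegrE// ler_nat dist_le.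
- by rewrite ltr0n muln_gt0/=; lia.
Qed.

(** One term of the exponential series at L = 1 + ln n gives L^(p+1) <= (p+1)! e n. Once L exceeds T
    = K e (p+1)!, which holds for n above e^T, this forces K L^p < n. *)
Lemma log_power_lt (K : R) (p : nat) : 0 <= K ->
  exists n0 : nat, forall n : nat, (n0 <= n)%N -> (0 < n)%N ->
    K * (1 + ln n%:R) ^+ p < n%:R.
Proof.
move=> K0; pose T : R := K * (expR 1 * p.+1`!%:R).
have T0 : 0 <= T by rewrite !mulr_ge0 ?expR_ge0.
exists (Num.bound (expR T)) => n nT n0; set L := 1 + ln n%:R.
have n1 : 0 < n%:R :> R by rewrite ltr0n.
have TL : T < L.
  have : T < ln n%:R.
    rewrite -ltr_expR lnK ?posrE//.
    by rewrite (lt_le_trans (archi_boundP (expR_ge0 T)))// ler_nat.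
  by rewrite /L; lra.
have L0 : 0 < L := le_lt_trans T0 TL.
have f0 : 0 < p.+1`!%:R :> R by rewrite ltr0n fact_gt0.
have := expR_ge1Dxn p (ltW L0); rewrite expRD lnK ?posrE// => h.
have : L ^+ p.+1 <= p.+1`!%:R * (expR 1 * n%:R).
  by rewrite mulrC -ler_pdivrMr//; lra.
apply: contraTT; rewrite -leNgt -ltNge => h1.
rewrite exprS; apply: le_lt_trans (_ : T * L ^+ p < _); last first.
  by rewrite ltr_pM2r ?exprn_gt0.
have -> : T * L ^+ p = p.+1`!%:R * (expR 1 * (K * L ^+ p)) by rewrite /T; ring.
by rewrite ler_pM2l// ler_pM2l ?expR_gt0.
Qed.

(** * Payoffs before and after the deviation *)

Lemma payoff0_le n k g (alpha : node n k -> R) (u : node n k) : 0 <= alpha u ->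
  payoff alpha (fun _ => strategy0 R g) u <=
    (k * n)%:R `^ alpha u / (n ^ k).-1%:R.
Proof.
move=> a0; have p0 v w : 0 <= link_prob v w 0 :> R.
  by rewrite mulr_ge0 ?powR_ge0// invr_ge0 sumr_ge0// => x _; exact: powR_ge0.
rewrite /payoff/= ler_pM ?powR_ge0//.
- by apply: sumr_ge0 => v _; rewrite mulr_ge0.
- rewrite ge0_ler_powR ?nnegrE ?mean_dist0_le//.
  by apply: sumr_ge0 => v _; rewrite mulr_ge0.
(* With N = n^k - 1, every link probability is 1 / N, so the reciprocity factor is N terms equal to
   N^(-2). *)
rewrite /link_prob oppr0.
under eq_bigr do rewrite !powRr0 !norm_const0 !div1r.
rewrite sumr_const card_others -[leLHS]mulr_natr -mulrA.
have [->|N0] := eqVneq ((n ^ k).-1%:R : R) 0; first by rewrite invr0 mul0r.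
by rewrite mulVf// mulr1.
Qed.

Lemma payoff_ge n k g (alpha : node n k.+1 -> R) (r : profile R g n k.+1)
    (u v : node n k.+1) (B : R) :
  (2 <= n)%N -> 0 <= alpha u -> dist u v = 1%N ->
  (forall w : node n k.+1, norm_const w k.+1%:R <= B) ->
  sval (r u) = k.+1%:R -> sval (r v) = k.+1%:R ->
  (n%:R / (2 * k.+1%:R ^+ k * B)) `^ alpha u / B ^+ 2 <= payoff alpha r u.
Proof.
move=> n2 a0 uv cB ru rv.
have vu : v != u.
  apply/eqP => vu; move: uv; rewrite vu distE big1// => i _.
  by rewrite /cdist distnn min0n.
have uv' : u != v by rewrite eq_sym.
have p0 x w r' : 0 <= link_prob x w r' :> R.
  by rewrite mulr_ge0 ?powR_ge0// invr_ge0 sumr_ge0// => y _; exact: powR_ge0.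
have cu0 := norm_const_gt0 k.+1%:R vu; have cv0 := norm_const_gt0 k.+1%:R uv'.
have B0 : 0 < B := lt_le_trans cu0 (cB u).
have q0 : 0 < 2 * k.+1%:R ^+ k :> R by rewrite mulr_gt0 ?exprn_gt0.
have D0 : 0 <= n%:R / (2 * k.+1%:R ^+ k * B).
  by rewrite divr_ge0// ltW// mulr_gt0.
rewrite /payoff ru ler_pM ?powR_ge0//.
- by rewrite invr_ge0 exprn_ge0// ltW.
- have h := mean_dist_ge u n2.
  have h' : n%:R / (2 * k.+1%:R ^+ k * B) <=
      n%:R / (2 * k.+1%:R ^+ k * norm_const u k.+1%:R).
    by rewrite ler_wpM2l// lef_pV2 ?posrE ?mulr_gt0// ler_pM2l.
  have hD := le_trans h' h; have D1 := le_trans D0 hD.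
  by rewrite ge0_ler_powR ?nnegrE.
(* At distance 1 the weight is 1 for any exponent, so the partner alone contributes 1 / (c(u) c(v))
   >= B^(-2); all other terms are nonnegative, whatever the remaining players do. *)
rewrite (bigD1 v)//= rv {1 2}/link_prob (distC v u) uv powR1 !div1r.
rewrite -[leLHS]addr0 lerD//; last by apply: sumr_ge0 => w _; rewrite mulr_ge0.
by rewrite -invfM lef_pV2 ?posrE ?mulr_gt0 ?exprn_gt0// ler_pM// ltW.
Qed.

(** With D the lower bound on the new mean distance and Q = 2 (k+1)^(k+1) B, the upper bound (k+1) n
    on the old one is exactly Q D. The factor D^alpha cancels, leaving Q^alpha B^2 < n^(k+1) - 1,
    and Q^alpha <= Q^m since Q >= 1. *)
Lemma pair_deviation_gain n k g m (alpha : node n k.+1 -> R)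
    (r : profile R g n k.+1) (u v : node n k.+1) (B : R) :
  (2 <= n)%N -> 0 <= alpha u <= m%:R -> dist u v = 1%N -> 1 <= B ->
  (forall w : node n k.+1, norm_const w k.+1%:R <= B) ->
  (2 * k.+1%:R ^+ k.+1 * B) ^+ m * B ^+ 2 < (n ^ k.+1).-1%:R ->
  sval (r u) = k.+1%:R -> sval (r v) = k.+1%:R ->
  payoff alpha (fun _ => strategy0 R g) u < payoff alpha r u.
Proof.
move=> n2 /andP[a0 am] uv B1 cB small ru rv.
have B0 : 0 < B := lt_le_trans ltr01 B1.
apply: le_lt_trans (payoff0_le g a0) _.
apply: lt_le_trans (payoff_ge n2 a0 uv cB ru rv).
set D := n%:R / _; set Q := 2 * k.+1%:R ^+ k.+1 * B in small *.
have D0 : 0 < D.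
  rewrite /D divr_gt0 ?mulr_gt0 ?exprn_gt0// ltr0n; lia.
have Q1 : 1 <= Q.
  rewrite mulr_ege1// -natrX -natrM ler1n muln_gt0 expn_gt0; lia.
have Q0 : 0 < Q := lt_le_trans ltr01 Q1.
have knE : (k.+1 * n)%:R = Q * D.
  rewrite /Q /D exprS natrM; field.
  by rewrite !gt_eqF ?exprn_gt0.
have N0 : 0 < (n ^ k.+1).-1%:R :> R.
  by apply: le_lt_trans small; rewrite mulr_ge0 ?exprn_ge0// ltW.
rewrite knE powRM ?(ltW Q0) ?(ltW D0)//.
rewrite ltr_pdivrMr// mulrAC ltr_pdivlMr ?exprn_gt0//.
rewrite mulrC mulrA mulrC ltr_pM2l ?powR_gt0// mulrC.
apply: le_lt_trans small; rewrite ler_pM2r ?exprn_gt0//.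
by rewrite -powR_mulrn ?(ltW Q0)// ler_powR.
Qed.

End Real.

(** * The profitable joint deviation for large n *)

Lemma strategy_nat (R : realType) (g m : nat) : (0 < g)%N -> @Sigma R g m%:R.
Proof.
move=> g0; exists (m * g)%N => //.
by rewrite natrM div1r mulfK// pnatr_eq0 -lt0n.
Qed.

Theorem theorem3p4 (R : realType) (k g : nat) (alpha_min alpha_max : R)
    (hk : (1 <= k)%N) (hg : (2 <= g)%N)
    (hmin : 0 < alpha_min) (hmax : alpha_min <= alpha_max) :
  exists n0 : nat, forall n : nat, (2 <= n)%N -> (n0 <= n)%N ->
  forall alpha : node n k -> R,
    (forall u, alpha_min <= alpha u <= alpha_max) ->
    ~ strong_nash alpha 2 (fun _ : node n k => strategy0 R g).
Proof.
case: k hk => // k _; pose m := Num.bound alpha_max.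
have amax : alpha_max < m%:R.
  by apply: archi_boundP; rewrite (le_trans (ltW hmin)).
pose q : R := 2 * k.+1%:R ^+ k.+1.
have q0 : 0 <= q by rewrite mulr_ge0 ?exprn_ge0.
(* The exponent of the harmonic sum in B^(m+2). *)
pose p := (k.+1 * (m + 2))%N.
have K0 : 0 <= 2 * (q ^+ m * 4 ^+ p) by rewrite !mulr_ge0 ?exprn_ge0.
(* The factor 2 in the constant pays for n <= 2 (n^(k+1) - 1). The threshold is fixed before the
   exponents are introduced. *)
have [n0 n0P] := log_power_lt p K0; exists n0.
move=> [|n']// n2 n0n alpha alphaP nash.
set n := n'.+1 in alpha alphaP nash n2 n0n.
pose B : R := (4 * harmonic_sum R n) ^+ k.+1.
have H1 : 1 <= 4 * harmonic_sum R n.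
  by have := harmonic_sum_ge1 R n'; rewrite -/n; lra.
have B1 : 1 <= B by rewrite exprn_ege1.
have small : (q * B) ^+ m * B ^+ 2 < (n ^ k.+1).-1%:R.
  have -> : (q * B) ^+ m * B ^+ 2 = q ^+ m * (4 * harmonic_sum R n) ^+ p.
    by rewrite exprMn -mulrA -exprD /B -exprM.
  apply: le_lt_trans (_ : q ^+ m * (4 * (1 + ln n%:R)) ^+ p < _).
    rewrite ler_wpM2l ?exprn_ge0// lerXn2r ?nnegrE ?(le_trans ler01)//.
      by rewrite (le_trans H1)// ler_pM2l// harmonic_sum_le.
    by rewrite ler_pM2l// harmonic_sum_le.
  have := n0P n n0n isT.
  have : n%:R <= 2 * (n ^ k.+1).-1%:R :> R.
    rewrite -natrM ler_nat.
    have : (n <= n ^ k.+1)%N by rewrite -{1}[n]expn1 leq_pexp2l.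
    by lia.
  by rewrite [(4 * _) ^+ p]exprMn mulrA -mulrA; lra.
pose u : node n k.+1 := [ffun _ => ord0].
(* The neighbour of the origin along the first axis; [inord 1] is genuinely 1 because n >= 2. *)
pose v : node n k.+1 := [ffun i => if i == ord0 then inord 1 else ord0].
have uv : dist u v = 1%N.
  rewrite distE (bigD1 ord0)//= big1 ?addn0 => [|i /negPf i0]; last first.
    by rewrite !ffunE i0 /cdist distnn min0n.
  by rewrite !ffunE /cdist/= inordK//; lia.
pose s : strategy R g := exist _ k.+1%:R (strategy_nat R k.+1 (ltnW hg)).
pose r : profile R g n k.+1 := fun _ => s.
(* Stated for an ordered pair, so that it serves both deviators: each gains strictly. *)
have gain w w' : dist w w' = 1%N -> w \in [set u; v] -> w' \in [set u; v] ->
    payoff alpha (fun _ => strategy0 R g) w <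
    payoff alpha (deviate [set u; v] r (fun _ => strategy0 R g)) w.
  move=> ww' wC w'C; have /andP[aw wa] := alphaP w.
  apply: (pair_deviation_gain (m := m) (v := w') n2 _ ww' B1 _ small).
  - by rewrite (le_trans (ltW hmin) aw) (le_trans wa (ltW amax)).
  - by move=> x; exact: norm_const_le.
  - by rewrite /deviate wC.
  - by rewrite /deviate w'C.
have gu := gain u v uv (set21 u v) (set22 u v).
have gv := gain v u (etrans (distC v u) uv) (set22 u v) (set21 u v).
apply: (nash [set u; v]).
- by apply/set0Pn; exists u; rewrite set21.
- by rewrite cards2; case: (u != v).
exists r; split; last by exists u; rewrite ?set21.
by move=> w /set2P[] ->; exact: ltW.
Qed.
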